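(* Let $A$, $D$ be self-adjoint operators on a Hilbert space with the same operator domain, $\mathcal{D}(A)=\mathcal{D}(D)$, and let $\gamma\in\mathbb{R}$. Denote $P_+=\mathsf{E}_A((\gamma,\infty))$, $Q_+=\mathsf{E}_D((\gamma,\infty))$, $P_-=1-P_+$, $Q_-=1-Q_+$, and $\mathcal{D}_\pm=\operatorname{Ran}Q_\pm\cap\mathcal{D}(D)=\operatorname{Ran}Q_\pm\cap\mathcal{D}(A)$. Suppose, in addition, that $D=A+B$ with some bounded self-adjoint operator $B$. If (i) $\langle x,(A-\gamma)x\rangle\le0$ for all $x\in\mathcal{D}_-$, and (ii) $\lVert Q_+P_-\rVert<1$, then $$\lambda_n(A|_{\operatorname{Ran}P_+})=\inf_{\substack{\mathfrak{M}_+\subset\mathcal{D}_+\\ \dim(\mathfrak{M}_+)=n}}\ \sup_{\substack{x\in\mathfrak{M}_+\oplus\mathcal{D}_-\\ \lVert x\rVert=1}}\langle x,Ax\rangle$$ for all $n\in\mathbb{N}$ with $n\le\dim(\operatorname{Ran}Q_+)$.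
   Context: $\mathsf{E}_A$ and $\mathsf{E}_D$ are the projection-valued spectral measures of $A$ and $D$; $1$ is the identity operator; the infimum runs over linear subspaces $\mathfrak{M}_+$. The standard Courant minimax values of the lower semi-bounded part $A|_{\operatorname{Ran}P_+}$ of $A$ associated with $\operatorname{Ran}P_+$ are $$\lambda_n(A|_{\operatorname{Ran}P_+})=\inf_{\substack{\mathfrak{M}\subset\operatorname{Ran}P_+\cap\mathcal{D}(A)\\ \dim(\mathfrak{M})=n}}\ \sup_{\substack{x\in\mathfrak{M}\\ \lVert x\rVert=1}}\langle x,Ax\rangle,\qquad n\in\mathbb{N},\ n\le\dim(\operatorname{Ran}P_+).$$ *)

(* Defs.v *)
From HB Require Import structures.
From mathcomp Require Import all_boot all_order all_algebra.
From mathcomp Require Import complex.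
From mathcomp Require Import all_classical all_reals all_analysis.
Set Implicit Arguments.
Unset Strict Implicit.
Unset Printing Implicit Defensive.
Import Order.TTheory GRing.Theory Num.Theory.
Import numFieldNormedType.Exports.
Local Open Scope classical_set_scope.
Local Open Scope ring_scope.
Local Open Scope complex_scope.

(* Complex Hilbert spaces, not necessarily separable.  The forms of type
   {dot V for _} are linear in the first and antilinear in the second
   argument. *)
HB.mixin Record isHilbert (R : realType) V of CompleteNormedModule R[i] V := {
  inner : {dot V for @Num.conj R[i]} ;
  sqr_norm_inner : forall x : V, `|x| ^+ 2 = inner x x
}.

#[short(type="hilbertType")]
HB.structure Definition Hilbert (R : realType) :=
  { V of CompleteNormedModule R[i] V & isHilbert R V }.

Section operators.
Context {R : realType} {H : hilbertType R}.

(* A linear operator H >= dom -> H, encoded by a total function whose values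
   outside of the subspace dom are irrelevant. *)
Record operator := Operator {
  dom : set H ;
  op_fun :> H -> H ;
  dom0 : dom 0 ;
  dom_linear : forall (a : R[i]) x y, dom x -> dom y -> dom (a *: x + y) ;
  op_linear : forall (a : R[i]) x y, dom x -> dom y ->
    op_fun (a *: x + y) = a *: op_fun x + op_fun y
}.

(* (y, z) belongs to the graph of the adjoint of A *)
Definition adjoint_graph (A : operator) (y z : H) : Prop :=
  forall x, dom A x -> inner (A x) y = inner x z.

Definition self_adjoint (A : operator) : Prop :=
  dense (dom A) /\
  forall y z, adjoint_graph A y z <-> dom A y /\ z = A y.

Definition bounded_operator (B : operator) : Prop :=
  dom B = setT /\ exists M : R, forall x, `|B x| <= M%:C * `|x|.

Definition is_sum (D A B : operator) : Prop :=
  dom D = dom A `&` dom B /\ forall x, dom D x -> D x = A x + B x.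

(* The operator norm of an everywhere defined linear map *)
Definition opnorm (T : H -> H) : \bar R :=
  ereal_sup [set (complex.Re `|T x|)%:E | x in [set x : H | `|x| <= 1]].

Definition orthogonal_projection (P : {linear H -> H}) : Prop :=
  (forall x, P (P x) = P x) /\ (forall x y, inner (P x) y = inner x (P y)).

(* Projection-valued measures on the Borel sets of R.  As for
   {measure set R -> \bar R}, E is a total function on set R; its values at
   non-measurable sets are irrelevant. *)
Record pvm := PVM {
  pvm_fun :> set R -> {linear H -> H} ;
  pvm_proj : forall S, orthogonal_projection (pvm_fun S) ;
  pvm0 : forall x, pvm_fun set0 x = 0 ;
  pvmT : forall x, pvm_fun setT x = x ;
  pvmI : forall S T, measurable S -> measurable T ->
    forall x, pvm_fun (S `&` T) x = pvm_fun S (pvm_fun T x) ;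
  pvm_sigma_additive : forall F : nat -> set R,
    (forall k, measurable (F k)) -> trivIset setT F ->
    forall x, (fun n => \sum_(0 <= k < n) pvm_fun (F k) x) @ \oo -->
              pvm_fun (\bigcup_k F k) x
}.

(* The measure S |-> <x, E(S) x> *)
Definition pvm_mass (E : pvm) (x : H) (S : set R) : \bar R :=
  (complex.Re (inner x (E S x)))%:E.

End operators.
Arguments operator {R} H.
Arguments pvm {R} H.

Section pvm_mass_measure.
Context {R : realType} {H : hilbertType R} (E : pvm H) (x : H).

Let inner_pvm S : inner x (E S x) = `|E S x| ^+ 2.
Proof.
have [idE symE] := pvm_proj E S.
by rewrite sqr_norm_inner symE idE.
Qed.

Lemma pvm_mass0 : pvm_mass E x set0 = 0%E.
Proof. by rewrite /pvm_mass inner_pvm pvm0 normr0 expr0n. Qed.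

Lemma pvm_mass_ge0 S : (0 <= pvm_mass E x S)%E.
Proof.
rewrite /pvm_mass inner_pvm lee_fin.
have : 0 <= `|E S x| ^+ 2 by rewrite exprn_ge0.
by rewrite lecE => /andP[].
Qed.

Lemma pvm_mass_sigma_additive : semi_sigma_additive (pvm_mass E x).
Proof.
move=> F mF tF mUF.
pose y n := \sum_(0 <= k < n) E (F k) x.
have Ey k n : (k < n)%N -> E (F k) (y n) = E (F k) x.
  move=> kn; rewrite /y raddf_sum /= (bigD1_seq k) ?mem_index_iota ?iota_uniq //=.
  rewrite -pvmI// setIid big1 ?addr0// => j jk.
  rewrite -pvmI// (_ : F k `&` F j = set0) ?pvm0//.
  by move/trivIsetP : tF; apply=> //; rewrite eq_sym.
have Hy n : inner x (y n) = `|y n| ^+ 2.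
  have inner_y z : inner z (y n) = \sum_(0 <= k < n) inner z (E (F k) x).
    by rewrite /y linear_sumr.
  rewrite sqr_norm_inner !inner_y !big_nat; apply: eq_bigr => k /andP[_ kn].
  have [_ symE] := pvm_proj E (F k).
  by rewrite -[RHS]symE Ey// symE.
have massE n : \sum_(0 <= k < n) pvm_mass E x (F k) =
               (complex.Re (`|y n| ^+ 2))%:E.
  rewrite -Hy /y linear_sumr raddf_sum sumEFin.
  by [].
rewrite (eq_cvg _ _ massE) /pvm_mass inner_pvm.
set L := `|E _ x|; have yL : `|y n| ^+ 2 @[n --> \oo] --> L ^+ 2.
  rewrite expr2; under eq_fun do rewrite expr2.
  have /cvg_norm yE := @pvm_sigma_additive _ _ E F mF tF x.
  exact: cvgM.
apply: cvg_EFin; first by near=> n.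
apply/cvgrPdist_lt => e e0.
have eC : 0 < e%:C by rewrite ltcR.
have /cvgrPdist_lt /(_ _ eC) := yL; apply: filterS => n /=.
rewrite -raddfB /= -ltcR; apply: le_lt_trans; exact: normc_ge_Re.
Unshelve. all: by end_near. Qed.

HB.instance Definition _ := isMeasure.Build _ _ _ (pvm_mass E x)
  pvm_mass0 pvm_mass_ge0 pvm_mass_sigma_additive.

End pvm_mass_measure.

Section spectral.
Context {R : realType} {H : hilbertType R}.

(* E is the spectral measure of A, that is, A = \int t dE(t): the domain of A
   is { x | \int t^2 d<x, E(t) x> < +oo } and <x, A x> = \int t d<x, E(t) x>
   on that domain.  By the spectral theorem, every self-adjoint A has exactly
   one spectral measure (up to the values at non-measurable sets). *)
Definition spectral_measure (A : operator H) (E : pvm H) : Prop :=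
  dom A = [set x | (\int[pvm_mass E x]_t (t ^+ 2)%:E < +oo)%E] /\
  forall x, dom A x ->
    (\int[pvm_mass E x]_t t%:E)%E = (complex.Re (inner x (A x)))%:E.

Definition lin_indep n (e : 'I_n -> H) : Prop :=
  forall c : 'I_n -> R[i], \sum_i c i *: e i = 0 -> forall i, c i = 0.

(* M is a linear subspace of dimension n *)
Definition has_dim (M : set H) (n : nat) : Prop :=
  exists e : 'I_n -> H, lin_indep e /\
    M = [set \sum_i c i *: e i | c in [set: 'I_n -> R[i]]].

(* n <= dim S, for a linear subspace S of finite or infinite dimension *)
Definition dim_ge (S : set H) (n : nat) : Prop :=
  exists e : 'I_n -> H, lin_indep e /\ forall i, S (e i).

(* The supremum of <x, A x> over the unit vectors x in M; for self-adjoint A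
   and M `<=` dom A, the number <x, A x> is real. *)
Definition sup_form (A : operator H) (M : set H) : \bar R :=
  ereal_sup [set (complex.Re (inner x (A x)))%:E
            | x in M `&` [set x : H | `|x| = 1]].

(* lambda_n(A|_{Ran P}).  For n > dim (Ran P), the infimum is over the empty
   set and the value is +oo. *)
Definition courant_value (A : operator H) (P : {linear H -> H}) (n : nat)
    : \bar R :=
  ereal_inf [set sup_form A M
            | M in [set M | M `<=` range P `&` dom A /\ has_dim M n]].

Definition sumset (M N : set H) : set H :=
  [set x + y | x in M & y in N].

End spectral.

(* Main.v *)
From HB Require Import structures.
Require Import Defs.
From mathcomp Require Import all_boot all_order all_algebra.
From mathcomp Require Import complex.
From mathcomp Require Import all_classical all_reals all_analysis.
From mathcomp Require Import measurable_realfun.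
From mathcomp Require Import ring lra.
Import Order.TTheory GRing.Theory Num.Theory.
Import numFieldNormedType.Exports.
Local Open Scope classical_set_scope.
Local Open Scope ring_scope.
Local Open Scope complex_scope.

(** Write q(x) = Re <x, A x> on the domain of A, and |x|^2 = Re <x, x>.  Two
    independent inequalities are proved.  In both, q(x) is the integral of t
    against the mass <x, E(.) x> of the spectral measure, so that q - s |.|^2
    is the sum of its values at E(S) x and x - E(S) x, is nonpositive on the
    range of E(S) if S lies below s, and is nonnegative there if S lies above s
    ([form_pvm_split], [form_pvm_le], [form_pvm_ge], [form_pvm_gt]).

    The right-hand side is at most the left-hand side ([courant_value_ge]).
    Let M be an n-dimensional subspace of Ran P_+ in the domain on which q is at
    most s |.|^2; then s > gamma.  With P_s = E_A(]gamma, s]), the space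
    M_s = P_s M still has dimension n: a vector of M killed by P_s lies in the
    range of E_A(]s, +oo[), where q > s |.|^2 off 0.  Moreover q <= s |.|^2 on
    M_s + D_-: for x = m + d, with b = d - P_s d, one has x - P_s x = b and
      q(x) - s |x|^2 <= q(b) - s |b|^2 <= q(b) - gamma |b|^2
                     <= q(d) - gamma |d|^2 <= 0.
    Finally M_+ = Q_+ M_s satisfies M_+ + D_- = M_s + D_-, and Q_+ is injective
    on Ran P_+ because the form of A - gamma is positive on Ran P_+ and
    nonpositive on D_-.

    The left-hand side is at most the right-hand side ([courant_value_le]).  It
    suffices that every e in D_+ be Q_+ y for some y in Ran P_+ in the domain:
    the preimages of a basis of M_+ then span an n-dimensional subspace of Ran P_+
    inside M_+ + D_-.  As |Q_+ P_-| < 1, the Neumann series z of (Q_+ P_-)^k e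
    converges, and y = P_+ z satisfies Q_+ y = e.  Since A and D commute with
    their spectral projections ([pvm_commute]) and D - A is bounded, the
    commutator of D and Q_+ P_- is bounded, so that the series of the
    D (Q_+ P_-)^k e converges geometrically as well; D being closed, z lies in its
    domain ([perturbed_pvm_onto]). *)

(** * The underlying real inner product *)

Section hilbert.
Context {R : realType} {H : hilbertType R}.
Implicit Types (x y z : H) (a : R).

(** The real part of the inner product: a real inner product on the underlying
    real vector space. *)
Definition rdot x y : R := complex.Re (inner x y).

(** The norm, as a real number rather than as an element of [R[i]]. *)
Definition rnorm x : R := complex.Re `|x|.

Lemma Re_conj (z : R[i]) : complex.Re (Num.conj z) = complex.Re z.
Proof. by case: z. Qed.

Lemma rdotC x y : rdot x y = rdot y x.
Proof.
by rewrite /rdot (hermC (inner : {dot H for @Num.conj R[i]})) expr0 mul1r Re_conj.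
Qed.

Lemma rdotDl x y z : rdot (x + y) z = rdot x z + rdot y z.
Proof. by rewrite /rdot linearDl raddfD. Qed.

Lemma rdotDr x y z : rdot x (y + z) = rdot x y + rdot x z.
Proof. by rewrite /rdot linearDr raddfD. Qed.

Lemma rdotZl a x y : rdot (a%:C *: x) y = a * rdot x y.
Proof. by rewrite /rdot linearZl_LR /=; case: (inner x y) => p q /=; ring. Qed.

Lemma rdotZr a x y : rdot x (a%:C *: y) = a * rdot x y.
Proof. by rewrite rdotC rdotZl rdotC. Qed.

Lemma rdotNl x y : rdot (- x) y = - rdot x y.
Proof. by rewrite /rdot linearNl raddfN. Qed.

Lemma rdotNr x y : rdot x (- y) = - rdot x y.
Proof. by rewrite rdotC rdotNl rdotC. Qed.

Lemma rdot0l x : rdot 0 x = 0.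
Proof. by rewrite -[0](subrr x) rdotDl rdotNl subrr. Qed.

Lemma rdot0r x : rdot x 0 = 0.
Proof. by rewrite rdotC rdot0l. Qed.

Lemma normE x : `|x| = (rnorm x)%:C.
Proof. by rewrite /rnorm RRe_real// ger0_real// normr_ge0. Qed.

Lemma rnorm_ge0 x : 0 <= rnorm x.
Proof. by rewrite -ler0c -normE normr_ge0. Qed.

Lemma rdotxx x : rdot x x = rnorm x ^+ 2.
Proof. by rewrite /rdot -sqr_norm_inner normE -rmorphXn. Qed.

Lemma rdotxx_ge0 x : 0 <= rdot x x.
Proof. by rewrite rdotxx sqr_ge0. Qed.

Lemma rdotxx_eq0 x : rdot x x = 0 -> x = 0.
Proof.
by rewrite rdotxx => /eqP; rewrite sqrf_eq0 => /eqP h; apply: normr0_eq0; rewrite normE h.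
Qed.

Lemma rnormD x y : rnorm (x + y) <= rnorm x + rnorm y.
Proof. by rewrite -lecR rmorphD /= -!normE ler_normD. Qed.

Lemma rnormN x : rnorm (- x) = rnorm x.
Proof. by rewrite /rnorm normrN. Qed.

Lemma rnormB x y : rnorm (x - y) <= rnorm x + rnorm y.
Proof. by rewrite -(rnormN y) rnormD. Qed.

Lemma rnormZ a x : rnorm (a%:C *: x) = `|a| * rnorm x.
Proof.
apply: (complexI (R := R)).
by rewrite rmorphM /= -!normE normrZ normc_def /= expr0n /= addr0 sqrtr_sqr.
Qed.

Lemma rnorm_sum m n (u : nat -> H) :
  rnorm (\sum_(m <= k < n) u k) <= \sum_(m <= k < n) rnorm (u k).
Proof.
rewrite -lecR -normE.
have -> : (\sum_(m <= k < n) rnorm (u k))%:C = \sum_(m <= k < n) `|u k|.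
  by rewrite rmorph_sum; apply: eq_bigr => k _; rewrite normE.
exact: ler_norm_sum.
Qed.

Lemma rdot_CauchySchwarz x y : `|rdot x y| <= rnorm x * rnorm y.
Proof.
have [x0|x0] := eqVneq (rnorm x) 0.
  have -> : x = 0 by apply/rdotxx_eq0; rewrite rdotxx x0 expr0n.
  by rewrite rdot0l normr0 mulr_ge0 ?rnorm_ge0.
have px : 0 < rnorm x by rewrite lt0r x0 rnorm_ge0.
rewrite -ler_sqr ?nnegrE ?mulr_ge0 ?rnorm_ge0// real_normK ?num_real//.
(* t x + y with this t is the component of y orthogonal to x *)
pose t := - rdot x y / rnorm x ^+ 2.
have := rdotxx_ge0 (t%:C *: x + y).
have -> : rdot (t%:C *: x + y) (t%:C *: x + y) =
          rnorm y ^+ 2 - rdot x y ^+ 2 / rnorm x ^+ 2.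
  rewrite !(rdotDl, rdotDr, rdotZl, rdotZr) (rdotC y x) !rdotxx /t.
  by field.
by rewrite subr_ge0 ler_pdivrMr ?exprn_gt0// exprMn mulrC.
Qed.

(** Real parts determine the inner product once multiplication by 1 and by the
    imaginary unit is allowed. *)
Lemma inner_rdot_inj x y z w :
  (forall a : R[i], rdot (a *: x) y = rdot (a *: z) w) -> inner x y = inner z w.
Proof.
move=> h; have := h 1; have := h 'i%C.
rewrite /rdot !linearZl_LR /= !mul1r.
case: (inner x y) => p q; case: (inner z w) => r s /=.
by rewrite !mul0r !mul1r !sub0r => /oppr_inj -> ->.
Qed.

End hilbert.

(** * Geometric series and closed operators *)

Section completeness.
Context {R : realType} {H : hilbertType R}.

(** A series whose terms decay geometrically converges in norm. *)
Lemma geometric_bound_cvg (u : nat -> H) (c r : R) : 0 <= r < 1 ->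
  (forall n, rnorm (u n) <= c * r ^+ n) ->
  exists l, forall e, 0 < e -> exists n0, forall n, (n0 <= n)%N ->
    rnorm (l - \sum_(0 <= k < n) u k) <= e.
Proof.
move=> /andP[r0 r1] hu.
have : cvgn (series (geometric c r)).
  by apply: is_cvg_geometric_series; rewrite ger0_norm.
move=> /cauchy_cvgP/cauchy_seriesP hg.
have : cvgn (series u).
  apply/cauchy_cvgP/cauchy_seriesP => e e0.
  have eE : e = (complex.Re e)%:C by rewrite RRe_real// gtr0_real.
  have /hg : 0 < complex.Re e by rewrite -ltcR -eE.
  apply: filterS => n /= hn.
  rewrite eE normE ltcR; apply: le_lt_trans hn.
  apply: le_trans (rnorm_sum _ _ _) _; apply: le_trans (ler_norm _).
  by apply: ler_sum => k _; exact: hu.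
move=> /cvg_ex[l /cvgrPdist_lt hl]; exists l => e e0.
have [|n0 _ hn] := hl e%:C; first by rewrite ltcR.
by exists n0 => n n0n; rewrite -lecR -normE ltW// hn.
Qed.

Lemma le_scaled_epsilon (x c : R) :
  (forall e, 0 < e -> x <= c * e) -> x <= 0.
Proof.
move=> h; rewrite leNgt; apply/negP => x0.
have c0 : 0 < c by have := h 1 ltr01; rewrite mulr1; apply: lt_le_trans.
have := h (x / (2 * c)); rewrite divr_gt0 ?mulr_gt0// => /(_ isT).
have -> : c * (x / (2 * c)) = x / 2 by field; rewrite gt_eqF.
by move=> h'; lra.
Qed.

End completeness.

Section operators.
Context {R : realType} {H : hilbertType R} (A : operator H).

Lemma op0 : A 0 = 0.
Proof.
have := op_linear 1 (dom0 A) (dom0 A).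
by rewrite !scale1r addr0 => /(congr1 (fun t => t - A 0)); rewrite subrr addrK.
Qed.

Lemma domZ a x : dom A x -> dom A (a *: x).
Proof. by move=> Ax; rewrite -[a *: x]addr0; apply: dom_linear => //; exact: dom0. Qed.

Lemma opZ a x : dom A x -> A (a *: x) = a *: A x.
Proof. by move=> Ax; rewrite -[a *: x]addr0 (op_linear _ Ax (dom0 A)) op0 addr0. Qed.

Lemma domD x y : dom A x -> dom A y -> dom A (x + y).
Proof. by move=> Ax Ay; rewrite -[x]scale1r; exact: dom_linear. Qed.

Lemma opD x y : dom A x -> dom A y -> A (x + y) = A x + A y.
Proof. by move=> Ax Ay; rewrite -[x]scale1r op_linear// !scale1r. Qed.

Lemma domB x y : dom A x -> dom A y -> dom A (x - y).
Proof. by move=> Ax Ay; rewrite addrC -scaleN1r; exact: dom_linear. Qed.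

Lemma opB x y : dom A x -> dom A y -> A (x - y) = A x - A y.
Proof. by move=> Ax Ay; rewrite addrC -scaleN1r op_linear// scaleN1r addrC. Qed.

Lemma dom_sum n (c : 'I_n -> R[i]) (e : 'I_n -> H) :
  (forall i, dom A (e i)) -> dom A (\sum_i c i *: e i).
Proof.
move=> Ae; elim/big_ind: _ => [|x y|i _]; [exact: dom0|exact: domD|exact: domZ].
Qed.

Lemma op_sum (u : nat -> H) m n : (forall k, dom A (u k)) ->
  dom A (\sum_(m <= k < n) u k) /\
  A (\sum_(m <= k < n) u k) = \sum_(m <= k < n) A (u k).
Proof.
move=> Au; elim/big_ind2: _ => [|x x' y y' [Ax <-] [Ay <-]|k _] //.
  by split; [exact: dom0|exact: op0].
by split; [exact: domD|exact: opD].
Qed.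

Lemma self_adjoint_rdot x y : self_adjoint A -> dom A x -> dom A y ->
  rdot (A x) y = rdot x (A y).
Proof. by move=> [_ saA] Ax Ay; rewrite /rdot (iffRL (saA y (A y)) (conj Ay erefl)). Qed.

(** The domain of a self-adjoint operator has trivial orthogonal complement:
    [(0, v)] lies in the graph of the adjoint. *)
Lemma self_adjoint_dom_perp v : self_adjoint A ->
  (forall u, dom A u -> rdot u v = 0) -> v = 0.
Proof.
move=> [_ saA] h; rewrite -op0; apply: (proj2 (iffLR (saA 0 v) _)) => x Ax.
apply: inner_rdot_inj => a.
by rewrite rdot0r h//; exact: domZ.
Qed.

(** A self-adjoint operator is closed: (l, w) belongs to its graph as soon as it is
    a limit of points (z, A z) of the graph. *)
Lemma self_adjoint_closed l w : self_adjoint A ->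
  (forall e : R, 0 < e -> exists z, [/\ dom A z, rnorm (l - z) <= e &
    rnorm (w - A z) <= e]) ->
  dom A l /\ w = A l.
Proof.
move=> saA h; apply/saA.2 => x Ax; apply: inner_rdot_inj => a.
rewrite -opZ//; have := domZ a _ Ax; move: (a *: x) => y Ay.
apply/eqP; rewrite -subr_eq0 -normr_le0.
apply: (@le_scaled_epsilon _ _ (rnorm (A y) + rnorm y)) => e /h[z [Az lz wz]].
have -> : rdot (A y) l - rdot y w = rdot (A y) (l - z) - rdot y (w - A z).
  by rewrite !rdotDr !rdotNr (self_adjoint_rdot _ _ saA Ay Az); ring.
apply: le_trans (ler_normB _ _) _; rewrite mulrDl; apply: lerD.
  apply: le_trans (rdot_CauchySchwarz _ _) _.
  by rewrite ler_wpM2l ?rnorm_ge0.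
apply: le_trans (rdot_CauchySchwarz _ _) _.
by rewrite ler_wpM2l ?rnorm_ge0.
Qed.

End operators.

(** * Projection-valued measures *)

Section pvm_calculus.
Context {R : realType} {H : hilbertType R} (E : pvm H).
Implicit Types (x : H) (S T : set R).

Lemma pvm_idem S x : E S (E S x) = E S x.
Proof. by have [idE _] := pvm_proj E S; exact: idE. Qed.

Lemma pvm_sym S x y : rdot (E S x) y = rdot x (E S y).
Proof. by have [_ symE] := pvm_proj E S; rewrite /rdot symE. Qed.

Lemma pvm_massE x S : pvm_mass E x S = (rdot (E S x) (E S x))%:E.
Proof. by rewrite pvm_sym pvm_idem. Qed.

Lemma pvm_mass_fin x : fin_num_fun (pvm_mass E x).
Proof. by []. Qed.

HB.instance Definition _ x := @Measure_isFinite.Build _ _ _ (pvm_mass E x)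
  (pvm_mass_fin x).

Lemma pvm_setC S x : measurable S -> E (~` S) x = x - E S x.
Proof.
move=> mS; have mSc := measurableC mS.
(* v is killed by both E S and E (~` S), so its mass vanishes *)
pose v := x - E S x - E (~` S) x.
suff v0 : v = 0 by apply/esym/eqP; rewrite -subr_eq0 -/v v0.
have ESv : E S v = 0.
  by rewrite /v !raddfB /= pvm_idem -pvmI// setICr pvm0 !subrr.
have ECv : E (~` S) v = 0.
  by rewrite /v !raddfB /= pvm_idem -pvmI// setICl pvm0 subr0 subrr.
have : pvm_mass E v setT = 0%E.
  rewrite -(setUv S) measureU//; last by rewrite setICr.
  by rewrite /= !pvm_massE ESv ECv rdot0l adde0.
by rewrite pvm_massE pvmT => -[] /rdotxx_eq0.
Qed.

Lemma pvm_pythagoras S x :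
  rdot x x = rdot (E S x) (E S x) + rdot (x - E S x) (x - E S x).
Proof.
rewrite !(rdotDl, rdotDr, rdotNl, rdotNr) !(pvm_sym S) pvm_idem.
by rewrite (rdotC _ (E S x)); ring.
Qed.

Lemma rnorm_pvm S x : rnorm (E S x) <= rnorm x.
Proof.
rewrite -ler_sqr ?nnegrE ?rnorm_ge0// -!rdotxx (pvm_pythagoras S x).
by rewrite lerDl rdotxx_ge0.
Qed.

Lemma rnorm_pvmC S x : rnorm (x - E S x) <= rnorm x.
Proof.
rewrite -ler_sqr ?nnegrE ?rnorm_ge0// -!rdotxx (pvm_pythagoras S x).
by rewrite lerDr rdotxx_ge0.
Qed.

Lemma range_pvmP S x : range (E S) x <-> E S x = x.
Proof. by split=> [[y _ <-]|<-]; [exact: pvm_idem|exists x]. Qed.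

Lemma range_pvmCP S x : range (idfun \- (E S : H -> H)) x <-> E S x = 0.
Proof.
split=> [[y _ <-]|Ex0]; first by rewrite /= raddfB /= pvm_idem subrr.
by exists x => //=; rewrite Ex0 subr0.
Qed.

Lemma pvm_mass_proj S T x : measurable S -> measurable T ->
  pvm_mass E (E S x) T = pvm_mass E x (T `&` S).
Proof. by move=> mS mT; rewrite !pvm_massE -pvmI. Qed.

(** The mass of E(S) x is the restriction to S of the mass of x. *)
Lemma integral_pvm_proj S x (f : R -> \bar R) : measurable S ->
  measurable_fun setT f ->
  (\int[pvm_mass E (E S x)]_t f t = \int[pvm_mass E x]_(t in S) f t)%E.
Proof.
move=> mS mf; have mSc := measurableC mS.
rewrite -(setUv S) integral_setU//.
- rewrite (eq_measure_integral (pvm_mass E x)) => [|T mT TS].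
    rewrite (eq_measure_integral mzero (D := ~` S)) => [|T mT TS].
      by rewrite integral_measure_zero adde0.
    rewrite /= pvm_mass_proj// (_ : T `&` S = set0) ?pvm_mass0//.
    by apply/disjoints_subset.
  by rewrite /= pvm_mass_proj// setIidl.
- by rewrite setUv.
- by rewrite disj_set2E setICr.
Qed.

End pvm_calculus.

(** * The quadratic form on spectral subspaces *)

Section spectral_forms.
Context {R : realType} {H : hilbertType R} (A : operator H) (E : pvm H).
Hypothesis spA : spectral_measure A E.
Implicit Types (x : H) (S T : set R).

Lemma integral_pvm_rdot x : dom A x ->
  (\int[pvm_mass E x]_t t%:E)%E = (rdot x (A x))%:E.
Proof. exact: spA.2. Qed.

Lemma dom_pvm S x : measurable S -> dom A x -> dom A (E S x).
Proof.
move=> mS; rewrite spA.1 /=; apply: le_lt_trans.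
have m2 : measurable_fun setT (fun t : R => (t ^+ 2)%:E).
  by apply/measurable_EFinP; exact: measurable_funX.
rewrite integral_pvm_proj//; apply: ge0_subset_integral => //.
by move=> t _; rewrite lee_fin sqr_ge0.
Qed.

Lemma dom_pvmC S x : measurable S -> dom A x -> dom A (x - E S x).
Proof. by move=> mS Ax; apply: domB => //; exact: dom_pvm. Qed.

Lemma integrable_id x : dom A x -> (pvm_mass E x).-integrable setT (@EFin R).
Proof.
move=> Ax; have m2 : measurable_fun setT (fun t : R => (t ^+ 2)%:E).
  by apply/measurable_EFinP; exact: measurable_funX.
have i2 : (pvm_mass E x).-integrable setT (fun t : R => (t ^+ 2)%:E).
  apply/integrableP; split => //; move: Ax; rewrite spA.1 /= => Ax.
  rewrite (eq_integral (fun t : R => (t ^+ 2)%:E))// => t _.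
  by rewrite /= ger0_norm// sqr_ge0.
have i1 := finite_measure_integrable_cst (pvm_mass E x) (1 : R) (@measurableT _ R).
apply: le_integrable (integrableD (@measurableT _ R) i1 i2) => //.
move=> t _ /=; rewrite lee_fin [leRHS]ger0_norm; last by rewrite addr_ge0 ?sqr_ge0.
(* the majorant is `|t| <= 1 + t ^+ 2 *)
have := sqr_ge0 (`|t| - 1); rewrite sqrrB real_normK ?num_real// expr1n mulr1.
have := normr_ge0 t; lra.
Qed.

Lemma form_pvm_split S x : measurable S -> dom A x ->
  rdot x (A x) = rdot (E S x) (A (E S x)) +
                 rdot (x - E S x) (A (x - E S x)).
Proof.
move=> mS Ax; have mSc := measurableC mS.
have dS := dom_pvm S x mS Ax; have dSc := dom_pvmC S x mS Ax.
apply: EFin_inj; rewrite EFinD -!integral_pvm_rdot//.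
rewrite -pvm_setC// !integral_pvm_proj// -integral_setU//; first by rewrite setUv.
by rewrite disj_set2E setICr.
Qed.

Lemma form_pvm_shift S (s : R) x : measurable S -> dom A x -> E S x = x ->
  (\int[pvm_mass E x]_(t in S) (t - s)%:E)%E =
  (rdot x (A x) - s * rdot x x)%:E.
Proof.
move=> mS Ax Ex.
have i1 : (pvm_mass E x).-integrable S (@EFin R).
  by apply: integrableS (integrable_id _ Ax).
have i2 : (pvm_mass E x).-integrable S (EFin \o cst s).
  exact: finite_measure_integrable_cst.
transitivity (\int[pvm_mass E x]_(t in S) (EFin t - (EFin \o cst s) t))%E.
  by apply: eq_integral => t _; rewrite EFinB.
have -> : (\int[pvm_mass E x]_(t in S) (EFin t - (EFin \o cst s) t) =
    \int[pvm_mass E x]_(t in S) EFin t - s%:E * pvm_mass E x S)%E.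
  by rewrite integralB// -(integral_cst (pvm_mass E x) mS).
by rewrite pvm_massE -integral_pvm_proj// Ex integral_pvm_rdot.
Qed.

Lemma form_pvm_le S (s : R) x : measurable S -> (forall t, S t -> t <= s) ->
  dom A x -> E S x = x -> rdot x (A x) <= s * rdot x x.
Proof.
move=> mS Ss Ax Ex; rewrite -subr_le0 -lee_fin -(form_pvm_shift S)//.
under eq_integral => t _ do rewrite -opprB EFinN.
rewrite integral_ge0N => [|t St]; last by rewrite lee_fin subr_ge0 Ss.
by rewrite leeNl oppe0; apply: integral_ge0 => t St; rewrite lee_fin subr_ge0 Ss.
Qed.

Lemma form_pvm_ge S (s : R) x : measurable S -> (forall t, S t -> s <= t) ->
  dom A x -> E S x = x -> s * rdot x x <= rdot x (A x).
Proof.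
move=> mS Ss Ax Ex; rewrite -subr_ge0 -lee_fin -(form_pvm_shift S)//.
by apply: integral_ge0 => t St; rewrite lee_fin subr_ge0 Ss.
Qed.

Lemma form_pvm_gt (s : R) x : dom A x -> E `]s, +oo[%classic x = x ->
  x <> 0 -> s * rdot x x < rdot x (A x).
Proof.
move=> Ax Ex x0; have mS : measurable `]s, +oo[%classic by [].
rewrite lt_neqAle (form_pvm_ge _ _ _ mS)// ?andbT; last first.
  by move=> t /=; rewrite in_itv/= andbT => /ltW.
(* otherwise the nonnegative function t - s has integral 0 on ]s, +oo[, so that this
   interval, where the function does not vanish, has mass 0 *)
apply/negP => /eqP eqx; apply: x0; apply: rdotxx_eq0; apply: EFin_inj.
have := form_pvm_shift _ s _ mS Ax Ex; rewrite eqx subrr => i0.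
have mf : measurable_fun `]s, +oo[%classic (fun t : R => (t - s)%:E).
  by apply/measurable_EFinP; apply: measurable_funB.
have : (\int[pvm_mass E x]_(t in `]s, +oo[) `|(t - s)%:E| = 0)%E.
  apply: etrans i0; apply: eq_integral => t; rewrite inE/= in_itv/= andbT => st.
  by rewrite /= ger0_norm// subr_ge0 ltW.
move=> /(iffLR (ae_eq_integral_abs _ mS mf))[N [mN N0 sN]].
rewrite -{1 2}Ex -pvm_massE; apply/eqP.
rewrite -measure_le0 -N0 le_measure ?inE//; apply: subset_trans sN => t /= st.
move=> /(_ st) [] /eqP; rewrite subr_eq0 => /eqP ts; move: st.
by rewrite in_itv/= ts ltxx.
Qed.

End spectral_forms.

(** * Commutation with the spectral projections *)

Section spectral_commutation.
Context {R : realType} {H : hilbertType R} (A : operator H) (E : pvm H).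
Hypotheses (saA : self_adjoint A) (spA : spectral_measure A E).
Implicit Types (x : H) (S T : set R).

(** Polarization of [form_pvm_split]. *)
Lemma form_pvm_orth S a b : measurable S -> dom A a -> dom A b ->
  E S a = a -> E S b = 0 -> rdot a (A b) = 0.
Proof.
move=> mS Aa Ab Ea Eb.
have := form_pvm_split _ _ spA _ _ mS (domD _ _ _ Aa Ab).
rewrite raddfD /= Ea Eb addr0 addrAC subrr add0r.
rewrite opD// !(rdotDl, rdotDr) (rdotC b (A a)) (self_adjoint_rdot _ _ _ saA Aa Ab).
lra.
Qed.

Lemma op_pvm_ker S b : measurable S -> dom A b -> E S b = 0 -> E S (A b) = 0.
Proof.
move=> mS Ab Eb; apply: (self_adjoint_dom_perp A _ saA) => u Au.
rewrite -pvm_sym (form_pvm_orth S)//; [exact: dom_pvm spA _ _ mS Au|exact: pvm_idem].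
Qed.

(** A self-adjoint operator commutes with its spectral projections. *)
Lemma pvm_commute S x : measurable S -> dom A x -> E S (A x) = A (E S x).
Proof.
move=> mS Ax; have mSc := measurableC mS.
have AEx := dom_pvm _ _ spA _ _ mS Ax.
have AEcx := dom_pvmC _ _ spA _ _ mS Ax.
have h1 : E S (A (x - E S x)) = 0.
  by apply: op_pvm_ker => //; rewrite raddfB /= pvm_idem subrr.
have h2 : E (~` S) (A (E S x)) = 0.
  by apply: op_pvm_ker => //; rewrite pvm_setC// pvm_idem subrr.
move: h2; rewrite pvm_setC// => /eqP; rewrite subr_eq0 => /eqP ->.
by move: h1; rewrite opB// raddfB /= => /eqP; rewrite subr_eq0 => /eqP.
Qed.

End spectral_commutation.

(** * Preimages in the domain under a bounded perturbation *)

Section bounded_perturbation.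
Context {R : realType} {H : hilbertType R}.
Variables (A D B : operator H) (EA ED : pvm H) (S T : set R) (q : R).
Hypotheses (saA : self_adjoint A) (saD : self_adjoint D).
Hypotheses (spA : spectral_measure A EA) (spD : spectral_measure D ED).
Hypotheses (domAD : dom A = dom D) (bB : bounded_operator B) (sumD : is_sum D A B).
Hypotheses (mS : measurable S) (mT : measurable T).
Hypotheses (q01 : 0 <= q < 1).

(* K is Q P_-, with Q = ED T and P_- = 1 - EA S *)
Let K (x : H) : H := ED T (x - EA S x).

Hypothesis Kq : forall x, rnorm (K x) <= q * rnorm x.

Let KD x y : K (x + y) = K x + K y.
Proof. by rewrite /K [EA S _]raddfD opprD addrACA raddfD. Qed.

Let KB x y : K (x - y) = K x - K y.
Proof. by rewrite /K [EA S _]raddfB opprD addrACA -opprD raddfB. Qed.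

Let K0 : K 0 = 0.
Proof. by have := KB 0 0; rewrite !subrr. Qed.

(* C is the commutator of D and K; it is bounded because D = A + B, and D commutes
   with Q, A with P_- *)
Let C (x : H) : H := ED T (B (x - EA S x)) - K (B x).

Let domK x : dom D x -> dom D (K x).
Proof.
move=> Dx; apply: dom_pvm spD _ _ mT _.
by rewrite -domAD; apply: dom_pvmC spA _ _ mS _; rewrite domAD.
Qed.

Let opK x : dom D x -> D (K x) = K (D x) + C x.
Proof.
move=> Dx; have Ax : dom A x by rewrite domAD.
have APx := dom_pvm _ _ spA _ _ mS Ax.
have DPx : dom D (x - EA S x) by rewrite -domAD; exact: dom_pvmC spA _ _ mS Ax.
rewrite /K -(pvm_commute _ _ saD spD)// (sumD.2 _ DPx).
rewrite (opB A)// -(pvm_commute _ _ saA spA)// -/(K (A x)).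
rewrite raddfD /= -/(K (A x)) (_ : A x = D x - B x); last first.
  by rewrite (sumD.2 _ Dx) addrK.
by rewrite KB /C -addrA [X in _ = _ + X]addrC.
Qed.

Let rnormC_le : exists2 M, 0 <= M & forall x, rnorm (C x) <= M * rnorm x.
Proof.
have [_ [M hM]] := bB.
have BM x : rnorm (B x) <= `|M| * rnorm x.
  have : rnorm (B x) <= M * rnorm x by rewrite -lecR rmorphM /= -!normE.
  move/le_trans; apply; apply: ler_wpM2r; [exact: rnorm_ge0|exact: ler_norm].
exists (`|M| + `|M|) => [|x]; first by rewrite addr_ge0.
apply: le_trans (rnormB _ _) _; rewrite mulrDl; apply: lerD.
  apply: le_trans (rnorm_pvm _ _ _) _; apply: le_trans (BM _) _.
  by rewrite ler_wpM2l// rnorm_pvmC.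
apply: le_trans (Kq _) _; apply: le_trans (BM _).
by rewrite ler_piMl ?rnorm_ge0//; case/andP: q01 => _ /ltW.
Qed.

(* Any rate r between q and 1 absorbs the linear growth n q ^+ (n - 1) produced by
   the commutator in D (K ^ n e). *)
Let iterK_bound e : dom D e -> exists c, exists2 r, 0 <= r < 1 &
  forall n, dom D (iter n K e) /\ rnorm (iter n K e) <= c * r ^+ n /\
            rnorm (D (iter n K e)) <= c * r ^+ n.
Proof.
move=> De; have [M M0 hM] := rnormC_le; have [q0 q1] := andP q01.
pose r := (1 + q) / 2.
have qr : q < r by rewrite /r; lra.
have r01 : 0 <= r < 1 by rewrite /r; apply/andP; split; lra.
have [r0 r1] := andP r01.
(* chosen so that q c + M |e| <= c r, which makes the bound inductive *)
pose c := M * rnorm e / (r - q) + (rnorm (D e) + rnorm e).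
have ne0 := rnorm_ge0 e; have nDe0 := rnorm_ge0 (D e).
have c0 : 0 <= M * rnorm e / (r - q) by rewrite divr_ge0 ?mulr_ge0// subr_ge0 ltW.
have zb n : rnorm (iter n K e) <= rnorm e * r ^+ n.
  elim: n => [|n IH]; first by rewrite expr0 mulr1.
  rewrite iterS; apply: le_trans (Kq _) _; rewrite exprS mulrCA.
  by apply: ler_pM => //; [exact: rnorm_ge0|exact: ltW].
exists c, r => // n.
have zd k : dom D (iter k K e) by elim: k => //= k; exact: domK.
split => //; split.
  by apply: le_trans (zb n) _; rewrite ler_wpM2r ?exprn_ge0// /c; lra.
elim: n => [|n IH]; first by rewrite expr0 mulr1 /c /=; lra.
rewrite iterS opK//; apply: le_trans (rnormD _ _) _.
apply: (@le_trans _ _ (q * (c * r ^+ n) + M * (rnorm e * r ^+ n))).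
  apply: lerD; first by apply: le_trans (Kq _) _; rewrite ler_wpM2l.
  by apply: le_trans (hM _) _; rewrite ler_wpM2l.
have -> : q * (c * r ^+ n) + M * (rnorm e * r ^+ n) =
          (q * c + M * rnorm e) * r ^+ n by ring.
rewrite exprS mulrA ler_wpM2r ?exprn_ge0//.
have -> : M * rnorm e = (r - q) * (M * rnorm e / (r - q)).
  by field; rewrite gt_eqF// subr_gt0.
rewrite -lerBrDl (_ : c * r - q * c = (r - q) * c); last by ring.
apply: ler_wpM2l; first by rewrite subr_ge0 ltW.
by rewrite /c lerDl addr_ge0.
Qed.

(** If Q P_- is a strict contraction, every e in the range of Q = ED T and in the
    domain has the preimage P z in the range of P = EA S and in the domain, where z
    is the Neumann series of the K ^ n e. *)
Lemma perturbed_pvm_onto e : dom D e -> ED T e = e ->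
  exists y, [/\ dom A y, EA S y = y & ED T y = e].
Proof.
move=> De Qe; have [c [r r01 hz]] := iterK_bound e De.
pose z n := iter n K e; pose s n := \sum_(0 <= k < n) z k.
have [l hl] := geometric_bound_cvg z c r r01 (fun n => (hz n).2.1).
have [w hw] := geometric_bound_cvg (D \o z) c r r01 (fun n => (hz n).2.2).
have [Dl _] : dom D l /\ w = D l.
  apply: self_adjoint_closed => // eps eps0.
  have [n1 h1] := hl _ eps0; have [n2 h2] := hw _ eps0.
  have [Ds Dse] := op_sum D z 0 (maxn n1 n2) (fun k => (hz k).1).
  exists (s (maxn n1 n2)); split => //; first by apply: h1; rewrite leq_maxl.
  by rewrite /s Dse; apply: h2; rewrite leq_maxr.
have sR n : s n.+1 = s n + z n by rewrite /s big_nat_recr.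
have sS n : s n.+1 = e + K (s n).
  elim: n => [|n IH]; first by rewrite sR /s big_geq// K0 add0r addr0.
  by rewrite sR {1}IH [in RHS]sR KD addrA.
have lK : l = e + K l.
  apply/eqP; rewrite -subr_eq0; apply/eqP/rdotxx_eq0; rewrite rdotxx.
  suff : rnorm (l - (e + K l)) <= 0.
    move=> h; have -> : rnorm (l - (e + K l)) = 0.
      by apply/eqP; rewrite eq_le h rnorm_ge0.
    by rewrite expr0n.
  apply: (@le_scaled_epsilon _ _ 2) => eps eps0; have [n hn] := hl _ eps0.
  have -> : l - (e + K l) = (l - s n.+1) - K (l - s n).
    by rewrite sS KB opprB !opprD !addrA addrNK.
  apply: le_trans (rnormB _ _) _; rewrite mulr2n mulrDl mul1r; apply: lerD.
    by apply: hn; exact: leqW.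
  apply: le_trans (Kq _) _; apply: le_trans (hn n _); rewrite ?leqnn//.
  by rewrite ler_piMl ?rnorm_ge0//; case/andP: q01 => _ /ltW.
exists (EA S l); split.
- by apply: dom_pvm spA _ _ mS _; rewrite domAD.
- exact: pvm_idem.
have Ql : ED T l = l by rewrite lK raddfD /= Qe pvm_idem.
have -> : ED T (EA S l) = l - K l by rewrite /K raddfB /= Ql subKr.
by rewrite {1}lK addrK.
Qed.

End bounded_perturbation.

Lemma opnorm_lt1P {R : realType} {H : hilbertType R} (K : H -> H) :
  (forall (a : R) x, K (a%:C *: x) = a%:C *: K x) -> (opnorm K < 1)%E ->
  exists2 q : R, 0 <= q < 1 & forall x, rnorm (K x) <= q * rnorm x.
Proof.
move=> KZ K1.
have K00 : K 0 = 0 by have := KZ 0 0; rewrite !scale0r.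
have ub x : `|x| <= 1 -> ((rnorm (K x))%:E <= opnorm K)%E.
  by move=> x1; apply: ereal_sup_ubound; exists x.
have rnorm0 : rnorm (0 : H) = 0 by rewrite /rnorm normr0.
have K0 : (0%:E <= opnorm K)%E.
  by have := ub 0; rewrite normr0 ler01 => /(_ isT); rewrite K00 rnorm0.
have Kfin : opnorm K \is a fin_num by rewrite ge0_fin_numE// (lt_trans K1)// ltry.
have Kq := fineK Kfin; exists (fine (opnorm K)) => [|x].
  by rewrite -lee_fin -lte_fin Kq K0 K1.
have [x0|x0] := eqVneq (rnorm x) 0.
  have -> : x = 0 by apply: rdotxx_eq0; rewrite rdotxx x0 expr0n.
  by rewrite K00 rnorm0 mulr0.
have px : 0 < rnorm x by rewrite lt0r x0 rnorm_ge0.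
have := ub ((rnorm x)^-1%:C *: x).
rewrite normE rnormZ KZ rnormZ ger0_norm ?invr_ge0 ?rnorm_ge0//.
rewrite mulVf// => /(_ (lexx _)); rewrite -Kq lee_fin.
by rewrite ler_pdivrMl// mulrC.
Qed.

(** * Rayleigh quotients on finite-dimensional subspaces *)

Section rayleigh.
Context {R : realType} {H : hilbertType R} (A : operator H).
Implicit Types (x : H) (M : set H) (s : R).

(** The linear span of a finite family. *)
Definition lin_span n (e : 'I_n -> H) : set H :=
  [set \sum_i c i *: e i | c in [set: 'I_n -> R[i]]].

Lemma lin_spanZ n (e : 'I_n -> H) a x : lin_span n e x -> lin_span n e (a *: x).
Proof.
move=> [c _ <-]; exists (fun i => a * c i) => //.
by rewrite scaler_sumr; apply: eq_bigr => i _; rewrite scalerA.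
Qed.

Lemma mem_lin_span n (e : 'I_n -> H) i : lin_span n e (e i).
Proof.
exists (fun j => (j == i)%:R) => //.
rewrite (bigD1 i)//= eqxx scale1r big1 ?addr0// => j /negPf ->.
by rewrite scale0r.
Qed.

Lemma lin_indep_neq0 n (e : 'I_n -> H) i : lin_indep e -> e i != 0.
Proof.
move=> he; apply/eqP => ei0.
suff : (i == i)%:R = 0 :> R[i] by rewrite eqxx => /eqP; rewrite oner_eq0.
apply: (he (fun j => (j == i)%:R)); rewrite (bigD1 i)//= ei0 scaler0 add0r.
by rewrite big1// => j /negPf ->; rewrite scale0r.
Qed.

Lemma lin_indep_map n (e : 'I_n -> H) (f : {linear H -> H}) : lin_indep e ->
  (forall x, lin_span n e x -> f x = 0 -> x = 0) -> lin_indep (f \o e).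
Proof.
move=> he hf c c0; apply: he; apply: hf; first by exists c.
by rewrite linear_sum -[RHS]c0; apply: eq_bigr => i _; rewrite linearZ.
Qed.

(** A nonzero vector has a positive real multiple of norm 1. *)
Lemma rnormalize x : x != 0 ->
  exists2 a : R, 0 < a & `|a%:C *: x| = 1 /\ a ^+ 2 * rdot x x = 1.
Proof.
move=> x0; have px : 0 < rnorm x.
  rewrite lt0r rnorm_ge0 andbT; apply: contra_neq x0 => x0.
  by apply: rdotxx_eq0; rewrite rdotxx x0 expr0n.
exists (rnorm x)^-1; first by rewrite invr_gt0.
rewrite normE rnormZ ger0_norm ?invr_ge0 ?rnorm_ge0// mulVf ?gt_eqF//.
by rewrite rdotxx exprVn mulVf// expf_neq0// gt_eqF.
Qed.

Lemma sup_form_le M s : (forall x, M x -> rdot x (A x) <= s * rdot x x) ->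
  (sup_form A M <= s%:E)%E.
Proof.
move=> h; apply: ge_ereal_sup => _ [x [Mx x1] <-]; rewrite lee_fin.
apply: le_trans (h _ Mx) _; rewrite rdotxx.
by rewrite /= normE in x1; rewrite (complexI x1) expr1n mulr1.
Qed.

Lemma sup_form_ge M x s : (forall a, M (a *: x)) -> dom A x ->
  (sup_form A M <= s%:E)%E -> rdot x (A x) <= s * rdot x x.
Proof.
move=> Mx Ax hs; have [->|/rnormalize[a a0 [a1 ax]]] := eqVneq x 0.
  by rewrite !rdot0l mulr0.
have : ((rdot (a%:C *: x) (A (a%:C *: x)))%:E <= s%:E)%E.
  by apply: le_trans hs; apply: ereal_sup_ubound; exists (a%:C *: x).
rewrite lee_fin opZ// rdotZl rdotZr mulrA => h.
rewrite -(ler_pM2l (exprn_gt0 2 a0)) mulrCA ax mulr1.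
by rewrite expr2; exact: h.
Qed.

End rayleigh.

(** * The two inequalities of the minimax principle *)

Section minimax.
Context {R : realType} {H : hilbertType R}.
Variables (A D : operator H) (EA ED : pvm H) (gamma : R).
Hypotheses (spA : spectral_measure A EA) (spD : spectral_measure D ED).
Hypothesis (domAD : dom A = dom D).

Let J : set R := `]gamma, +oo[%classic.
Let mJ : measurable J. Proof. exact: measurable_itv. Qed.

Let Dplus : set H := range (ED J) `&` dom D.
Let Dminus : set H := range (idfun \- (ED J : H -> H)) `&` dom D.

Let DminusP x : Dminus x <-> ED J x = 0 /\ dom A x.
Proof. by rewrite /Dminus domAD; split=> -[/range_pvmCP]. Qed.

Let subDplus n (e : 'I_n -> H) : (forall i, dom A (e i)) ->
  (forall i, ED J (e i) = e i) -> lin_span n e `<=` Dplus.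
Proof.
move=> Ae Qe _ [c _ <-]; split; last by rewrite -domAD; exact: dom_sum.
apply/range_pvmP; rewrite linear_sum; apply: eq_bigr => i _.
by rewrite linearZ Qe.
Qed.

(** Preimages under Q_+ of a basis of Mp span a competitor inside [Mp + Dminus]. *)
Lemma courant_value_le n (Mp : set H) :
  (forall e, dom A e -> ED J e = e ->
    exists y, [/\ dom A y, EA J y = y & ED J y = e]) ->
  Mp `<=` Dplus -> has_dim Mp n ->
  (courant_value A (EA J) n <= sup_form A (sumset Mp Dminus))%E.
Proof.
move=> onto MpD [e [he eMp]].
have De i : exists y, [/\ dom A y, EA J y = y & ED J y = e i].
  have [/range_pvmP Qe Ae] : Dplus (e i) by apply: MpD; rewrite eMp; exact: mem_lin_span.
  by apply: onto => //; rewrite domAD.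
have [y yP] := choice De.
have Ay i : dom A (y i) by have [] := yP i.
apply: ge_ereal_inf; exists (sup_form A (lin_span n y)).
  exists (lin_span n y) => //; split.
    move=> _ [c _ <-]; split; last exact: dom_sum.
    apply/range_pvmP; rewrite linear_sum; apply: eq_bigr => i _.
    by rewrite linearZ; have [_ -> _] := yP i.
  exists y; split => // c c0; apply: he.
  have /(congr1 (ED J)) := c0; rewrite linear0 linear_sum => Qc0.
  rewrite -[RHS]Qc0.
  by apply: eq_bigr => i _; rewrite linearZ; have [_ _ ->] := yP i.
apply: ereal_sup_le => _ [x [[c _ <-] x1] <-]; exists (\sum_i c i *: y i) => //.
split => //; exists (\sum_i c i *: e i); first by rewrite eMp; exists c.
exists (\sum_i c i *: y i - \sum_i c i *: e i); last by rewrite addrC subrK.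
apply/DminusP; split; last first.
  apply: domB; first exact: dom_sum.
  apply: dom_sum => i; rewrite domAD.
  by have [] : Dplus (e i) by apply: MpD; rewrite eMp; exact: mem_lin_span.
apply/eqP; rewrite linearB subr_eq0 !linear_sum; apply/eqP; apply: eq_bigr => i _.
by rewrite !linearZ; have [_ _ Qy] := yP i; rewrite -[in RHS]Qy pvm_idem.
Qed.

Hypothesis formDminus : forall x, ED J x = 0 -> dom A x ->
  rdot x (A x) <= gamma * rdot x x.

Lemma pvm_plus_inj m : dom A m -> EA J m = m -> ED J m = 0 -> m = 0.
Proof.
move=> Am Pm Qm; apply/eqP; apply: contraTT (formDminus m Qm Am) => /eqP m0.
by rewrite -ltNge; exact: form_pvm_gt spA _ _ Am Pm m0.
Qed.

(** The form of A is at most s on Ran E_A(]gamma, s]) + D_-. *)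
Lemma form_sum_le (s : R) m d : gamma <= s -> dom A m -> dom A d ->
  EA `]gamma, s]%classic m = m -> ED J d = 0 ->
  rdot (m + d) (A (m + d)) <= s * rdot (m + d) (m + d).
Proof.
move=> gs Am Ad Pm Qd; set S := `]gamma, s]%classic in Pm *.
have mS : measurable S by exact: measurable_itv.
set b := d - EA S d; set a := EA S (m + d).
have Aa : dom A a by apply: dom_pvm spA _ _ mS _; exact: domD.
have ASd := dom_pvm _ _ spA _ _ mS Ad.
have -> : rdot (m + d) (A (m + d)) = rdot a (A a) + rdot b (A b).
  rewrite (form_pvm_split _ _ spA S)//; last exact: domD.
  by rewrite -/a (_ : m + d - a = b)// /a raddfD /= Pm opprD addrACA subrr add0r.
have -> : rdot (m + d) (m + d) = rdot a a + rdot b b.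
  rewrite (pvm_pythagoras EA S).
  by rewrite -/a (_ : m + d - a = b)// /a raddfD /= Pm opprD addrACA subrr add0r.
have ha : rdot a (A a) <= s * rdot a a.
  apply: (form_pvm_le _ _ spA S) => // [t|]; last exact: pvm_idem.
  by rewrite /S /= in_itv/= => /andP[].
have hSd : gamma * rdot (EA S d) (EA S d) <= rdot (EA S d) (A (EA S d)).
  apply: (form_pvm_ge _ _ spA S) => // [t|]; last exact: pvm_idem.
  by rewrite /S /= in_itv/= => /andP[/ltW].
have hd := formDminus d Qd Ad.
rewrite (form_pvm_split _ _ spA S _ mS Ad) (pvm_pythagoras EA S d) -/b in hd.
have hb : gamma * rdot b b <= s * rdot b b by rewrite ler_wpM2r// rdotxx_ge0.
lra.
Qed.

(** The competitor is [ED J (EA ]gamma, s] M)], where s is the supremum of the form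
    on the unit sphere of M. *)
Lemma courant_value_ge n (M : set H) : (0 < n)%N ->
  M `<=` range (EA J) `&` dom A -> has_dim M n ->
  (ereal_inf [set sup_form A (sumset Mp Dminus)
            | Mp in [set Mp | Mp `<=` Dplus /\ has_dim Mp n]] <= sup_form A M)%E.
Proof.
move=> n0 MP [e [he eM]].
have PM x : M x -> EA J x = x by move=> /MP[/range_pvmP].
have AM x : M x -> dom A x by move=> /MP[].
have MZ a x : M x -> M (a *: x) by rewrite eM; exact: lin_spanZ.
have Me i : M (e i) by rewrite eM; exact: mem_lin_span.
case hs : (sup_form A M) => [s| |]; last 2 first.
- exact: leey.
- have [a a0 [a1 _]] := rnormalize _ (lin_indep_neq0 _ _ (Ordinal n0) he).
  have : ((rdot (a%:C *: e (Ordinal n0)) (A (a%:C *: e (Ordinal n0))))%:E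
          <= sup_form A M)%E.
    by apply: ereal_sup_ubound; exists (a%:C *: e (Ordinal n0)) => //; split => //; exact: MZ.
  by rewrite hs leeNy_eq.
have Ms x : M x -> rdot x (A x) <= s * rdot x x.
  by move=> Mx; apply: (sup_form_ge _ M) => [a||]; [exact: MZ|exact: AM|rewrite hs].
have gs : gamma < s.
  have e0 := lin_indep_neq0 _ _ (Ordinal n0) he.
  have := Ms _ (Me (Ordinal n0)); set x := e _ in e0 *.
  have : gamma * rdot x x < rdot x (A x).
    by apply: form_pvm_gt spA _ _ _ _ _; [exact: AM (Me _)|exact: PM (Me _)|exact/eqP].
  move=> /lt_le_trans h /h; rewrite ltr_pM2r// lt0r rdotxx_ge0 andbT.
  by apply: contra_neq e0 => /rdotxx_eq0.
pose S : set R := `]gamma, s]%classic; have mS : measurable S by exact: measurable_itv.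
have SJ : S `&` J = S.
  by apply: setIidl => t; rewrite /S /J /= !in_itv/= andbT => /andP[].
have JS : ~` S `&` J = `]s, +oo[%classic.
  apply/seteqP; split=> t; rewrite /S /J /= !in_itv/= !andbT.
    by move=> [/negP]; rewrite negb_and -leNgt -ltNge => /orP[h1 h2|//]; lra.
  by move=> st; split; [apply/negP; rewrite negb_and -ltNge st orbT|lra].
have Sinj m : M m -> EA S m = 0 -> m = 0.
  move=> Mm Sm; apply/eqP; apply: contraTT (Ms _ Mm) => /eqP m0.
  rewrite -ltNge; apply: form_pvm_gt spA _ _ (AM _ Mm) _ m0.
  rewrite -JS pvmI//; last exact: measurableC.
  by rewrite PM// pvm_setC// Sm subr0.
pose f i := EA S (e i); pose g i := ED J (f i).
have Af i : dom A (f i) by apply: dom_pvm spA _ _ mS _; exact: AM.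
have Ag i : dom A (g i) by rewrite domAD; apply: dom_pvm spD _ _ mJ _; rewrite -domAD.
have Sf c : EA S (\sum_i c i *: f i) = \sum_i c i *: f i.
  by rewrite linear_sum; apply: eq_bigr => i _; rewrite linearZ /= /f pvm_idem.
have Jf c : EA J (\sum_i c i *: f i) = \sum_i c i *: f i.
  by rewrite -Sf -pvmI// setIC SJ.
have lf : lin_indep f.
  by apply: (lin_indep_map _ e (EA S) he) => x xe; apply: Sinj; rewrite eM.
have lg : lin_indep g.
  apply: (lin_indep_map _ f (ED J) lf) => _ [c _ <-].
  by apply: pvm_plus_inj => //; exact: dom_sum.
apply: ge_ereal_inf; exists (sup_form A (sumset (lin_span n g) Dminus)).
  exists (lin_span n g) => //; split; last by exists g.
  by apply: subDplus => // i; exact: pvm_idem.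
apply: sup_form_le => _ [_ [c _ <-]] [d /DminusP[Qd Ad] <-].
pose m := \sum_i c i *: f i.
have Am : dom A m by exact: dom_sum.
have Qm : \sum_i c i *: g i = ED J m.
  by rewrite linear_sum; apply: eq_bigr => i _; rewrite linearZ.
have AQm : dom A (ED J m) by rewrite domAD; apply: dom_pvm spD _ _ mJ _; rewrite -domAD.
(* replacing Q_+ m by m changes only the component in D_- *)
have -> : \sum_i c i *: g i + d = m + (d - (m - ED J m)).
  by rewrite Qm opprB addrCA [m + _]addrC subrK addrC.
apply: form_sum_le => //; first exact: ltW.
- by apply: domB => //; exact: domB.
- exact: Sf.
- by rewrite !linearB /= Qd pvm_idem subrr addr0.
Qed.

End minimax.

Theorem theoremA2 (R : realType) (H : hilbertType R)
  (A D B : operator H) (EA ED : pvm H) (gamma : R)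
  (hA : self_adjoint A) (hD : self_adjoint D)
  (hEA : spectral_measure A EA) (hED : spectral_measure D ED)
  (hdom : dom A = dom D)
  (hBb : bounded_operator B) (hBs : self_adjoint B) (hDAB : is_sum D A B) :
  let Pp : {linear H -> H} := EA `]gamma, +oo[%classic in
  let Qp : {linear H -> H} := ED `]gamma, +oo[%classic in
  let Pm : H -> H := idfun \- Pp in
  let Qm : H -> H := idfun \- Qp in
  let Dp := range Qp `&` dom D in
  let Dm := range Qm `&` dom D in
  (forall x : H, Dm x -> inner x (A x - gamma%:C *: x) <= 0) ->
  (opnorm (Qp \o Pm) < 1)%E ->
  forall n : nat, (0 < n)%N -> dim_ge (range Qp) n ->
  courant_value A Pp n =
  ereal_inf [set sup_form A (sumset Mp Dm)
            | Mp in [set Mp | Mp `<=` Dp /\ has_dim Mp n]].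
Proof.
move=> Pp Qp Pm Qm Dp Dm formDm QP n n0 _.
have formDm' x : Qp x = 0 -> dom A x -> rdot x (A x) <= gamma * rdot x x.
  move=> Qx Ax; have : Dm x by split; [exact/range_pvmCP|rewrite -hdom].
  move=> /formDm; rewrite lecE => /andP[_].
  by rewrite -/(rdot _ _) rdotDr rdotNr rdotZr subr_le0.
have KZ (a : R) x : (Qp \o Pm) (a%:C *: x) = a%:C *: (Qp \o Pm) x.
  by rewrite /Pm /= linearZ /= -scalerBr linearZ.
have [q q01 Kq] := opnorm_lt1P _ KZ QP.
apply/eqP; rewrite eq_le; apply/andP; split.
  apply: le_ereal_inf_tmp => _ [Mp [MpD Mpn] <-].
  apply: (courant_value_le A D EA ED gamma) => // e Ae Qe.
  by apply: (perturbed_pvm_onto A D B EA ED _ _ q) => //; rewrite -hdom.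
apply: le_ereal_inf_tmp => _ [M [MP Mn] <-].
exact: (courant_value_ge A D EA ED gamma).
Qed.
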